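(* Let $A$ be a free abelian group. (i) Suppose $A$ has finite rank. (a) If $A$ is a non-transitive self-similar group then $\Delta(A)$ is not finitely generated. (b) Let $A$ be a transitive self-similar subgroup of $\mathcal{A}_m$. Then the self-similar representation of $A$ extends to a non-transitive self-similar representation into $\mathcal{A}_{m+1}$ having orbit-type $(m,1)$ such that $\Delta(A)$, with respect to the second representation, contains a self-similar free abelian group of infinite enumerable (i.e. countably infinite) rank. (ii) Suppose $A$ has infinite countable rank. Then $A$ can be realized as a self-similar group of orbit-type $(m,1)$, invariant with respect to $\Delta=\langle x_1,x_2\rangle$.
   Context: Tree automorphisms. For $n\ge 2$, $Y=\{1,\dots,n\}$, $\mathcal{T}_n$ is the rooted $n$-ary tree whose vertices are the finite words over $Y$ (root the empty word, edges $(u,uy)$ with $y\in Y$), and $\mathcal{A}_n$ is its automorphism group, acting on the right. Each $\alpha\in\mathcal{A}_n$ is written $\alpha=(\alpha_1,\dots,\alpha_n)\sigma(\alpha)$, where $\sigma(\alpha)\in Sym(Y)$ is the permutation induced on the first level, $\alpha_y\in\mathcal{A}_n$, and $(y_1y_2\cdots y_k)^{\alpha}=(y_1)^{\sigma(\alpha)}(y_2\cdots y_k)^{\alpha_{y_1}}$. The set of states of $\alpha$ is defined recursively by $Q(\alpha)=\{\alpha\}\cup\bigcup_{i}Q(\alpha_i)$. A subgroup $G\leqslant\mathcal{A}_n$ is self-similar if $Q(\alpha)\subseteq G$ for all $\alpha\in G$, and transitive if it acts transitively on $Y$. A self-similar representation of a group is a homomorphism to some $\mathcal{A}_n$ whose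 image is self-similar. The identity is $e$. Orbits and $\Delta$. For $G\leqslant\mathcal{A}_n$, the orbits of $G$ on $Y$ are $O_{(1)}=\{1,\dots,m_1\}$, $O_{(2)}=\{m_1+1,\dots,m_1+m_2\}$, $\dots$, $O_{(s)}=\{m_1+\dots+m_{s-1}+1,\dots,n\}$; $(m_1,\dots,m_s)$ is the orbit-type of $G$. For $1\le i\le s$, $x_i:\mathcal{A}_n\to\mathcal{A}_n$ sends $\alpha$ to the automorphism with trivial action on the first level having $\alpha$ in every coordinate from $O_{(i)}$ and $e$ in all other coordinates. $\Delta=\langle x_1,\dots,x_s\rangle$ is the monoid generated under composition (maps written on the right as exponents), and $\Delta(G)=\langle G^{\omega}\mid\omega\in\Delta\rangle$. $G$ is invariant with respect to $\Delta$ if $\Delta(G)=G$. For orbit-type $(m,1)$ in $\mathcal{A}_{m+1}$: $\alpha^{x_1}=(\alpha,\dots,\alpha,e)$ and $\alpha^{x_2}=(e,\dots,e,\alpha)$.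
   Formalization: In (i)(a) the rank of A is assumed to be at least 1: for the trivial group (rank 0), which is self-similar and non-transitive, Δ(A) = {e} is finitely generated, so the claim fails there. *)

(* Defs.v *)
From HB Require Import structures.
From mathcomp Require Import all_boot all_order all_algebra perm.
From mathcomp Require Import mathcomp_extra boolp classical_sets.

Set Implicit Arguments.
Unset Strict Implicit.
Unset Printing Implicit Defensive.

Local Open Scope classical_set_scope.
Local Open Scope group_scope.

(* The alphabet Y = {1, ..., n} is 'I_n (0-based), and the vertices of the
   n-ary tree are the words w : seq 'I_n. *)
Definition edge n (u v : seq 'I_n) : bool := [exists y, v == rcons u y].

Definition is_tree_automorphism n (f : seq 'I_n -> seq 'I_n) : Prop :=
  [/\ bijective f, f [::] = [::] & {mono f : u v / edge u v}].

Record tree_aut n := Aut {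
  aut_fun :> seq 'I_n -> seq 'I_n;
  autP : is_tree_automorphism aut_fun }.

HB.instance Definition _ n := gen_eqMixin (tree_aut n).
HB.instance Definition _ n := gen_choiceMixin (tree_aut n).

Lemma autE n (a b : tree_aut n) : a =1 b -> a = b.
Proof.
case: a b => [f fP] [g gP] /= /funext fg; move: fP gP; rewrite fg => fP gP.
by rewrite (Prop_irrelevance fP gP).
Qed.

Section AutGroup.
Variable n : nat.
Implicit Types a b c : tree_aut n.

Lemma aut_one_subproof : is_tree_automorphism (@id (seq 'I_n)).
Proof. by split=> //; exists id. Qed.
Definition aut_one := Aut aut_one_subproof.

Lemma aut_mul_subproof a b : is_tree_automorphism (b \o a).
Proof.
case: a b => [f [fb f0 fe]] [g [gb g0 ge]]; split=> /=.
- exact: bij_comp.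
- by rewrite f0.
- by move=> u v; rewrite /= ge fe.
Qed.
(* Right action: a * b is "first a, then b". *)
Definition aut_mul a b := Aut (aut_mul_subproof a b).

Lemma aut_inv_exists a : exists b, cancel a b /\ cancel b a.
Proof.
case: a => [f [[g fK gK] f0 fe]] /=.
have gP : is_tree_automorphism g.
  split; first by exists f.
    by rewrite -f0 fK.
  by move=> u v; rewrite -fe !gK.
by exists (Aut gP).
Qed.
Definition aut_inv a := projT1 (cid (aut_inv_exists a)).

Lemma aut_invK a : cancel a (aut_inv a).
Proof. by rewrite /aut_inv; case: (cid _) => b []. Qed.
Lemma autK_inv a : cancel (aut_inv a) a.
Proof. by rewrite /aut_inv; case: (cid _) => b []. Qed.

Fact aut_mulA : associative aut_mul.
Proof. by move=> a b c; apply: autE. Qed.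
Fact aut_mul1 : left_id aut_one aut_mul.
Proof. by move=> a; apply: autE. Qed.
Fact aut_mulr1 : right_id aut_one aut_mul.
Proof. by move=> a; apply: autE. Qed.
Fact aut_mulV : left_inverse aut_one aut_inv aut_mul.
Proof. by move=> a; apply: autE => w /=; rewrite autK_inv. Qed.
Fact aut_mulrV : right_inverse aut_one aut_inv aut_mul.
Proof. by move=> a; apply: autE => w /=; rewrite aut_invK. Qed.

HB.instance Definition _ :=
  isGroup.Build (tree_aut n) aut_mulA aut_mul1 aut_mulr1 aut_mulV aut_mulrV.

Lemma edge_cons y z (u v : seq 'I_n) :
  edge (y :: u) (z :: v) = (y == z) && edge u v.
Proof.
apply/existsP/andP => [[t /=]|[/eqP-> /existsP[t vE]]].
  by rewrite eqseq_cons eq_sym => /andP[-> vE]; split=> //; apply/existsP; exists t.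
by exists t; rewrite /= eqseq_cons eqxx.
Qed.

Lemma aut_cat a u v :
  exists2 v', a (u ++ v) = a u ++ v' & size v' = size v.
Proof.
elim/last_ind: v => [|v y [v' avE sv]].
  by exists [::]; rewrite ?cats0.
have : edge (a (u ++ v)) (a (u ++ rcons v y)).
  case: (autP a) => _ _ ->; apply/existsP; exists y.
  by rewrite rcons_cat.
case/existsP => t /eqP->; exists (rcons v' t).
  by rewrite avE rcons_cat.
by rewrite !size_rcons sv.
Qed.

Lemma size_aut a w : size (a w) = size w.
Proof.
have [v /= aE <-] := aut_cat a [::] w.
by rewrite aE; case: (autP a) => _ ->.
Qed.

Lemma edge0 (w : seq 'I_n) : edge [::] w = (size w == 1%N).
Proof.
apply/existsP/idP => [[t /eqP->] //|].
by case: w => [|t []] // _; exists t.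
Qed.

Lemma edges0 (w : seq 'I_n) : edge w [::] = false.
Proof. by apply/existsP => -[t]; case: w. Qed.

Definition level1 a (y : 'I_n) : 'I_n := head y (a [:: y]).

Lemma level1E a y : a [:: y] = [:: level1 a y].
Proof.
rewrite /level1; have [v] := aut_cat a [::] [:: y].
by case: (autP a) => _ -> _ /= ->; case: v => [|t []].
Qed.

Lemma level1_inj a : injective (level1 a).
Proof.
move=> y z yz; suff: [:: y] = [:: z] by case.
by apply: (can_inj (aut_invK a)); rewrite !level1E yz.
Qed.

Definition sigma a : {perm 'I_n} := perm (@level1_inj a).

Definition section_fun a (y : 'I_n) (w : seq 'I_n) := behead (a (y :: w)).

Lemma section_funE a y w : a (y :: w) = sigma a y :: section_fun a y w.
Proof.
by rewrite /section_fun permE; have [v] := aut_cat a [:: y] w; rewrite level1E /= => ->.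
Qed.

Lemma section_subproof a y : is_tree_automorphism (section_fun a y).
Proof.
have sK : aut_inv a [:: sigma a y] = [:: y].
  by rewrite permE -level1E aut_invK.
have sVK : sigma (aut_inv a) (sigma a y) = y.
  by move: sK; rewrite section_funE => -[].
split.
- exists (section_fun (aut_inv a) (sigma a y)) => w.
    by rewrite {1}/section_fun -section_funE aut_invK.
  by rewrite {1}/section_fun -{1}sVK -section_funE autK_inv.
- by rewrite /section_fun level1E.
- move=> u v; have [_ _ /(_ (y :: u) (y :: v))] := autP a.
  by rewrite !section_funE !edge_cons !eqxx.
Qed.
Definition section a y := Aut (section_subproof a y).

Lemma aut_cons a y w : a (y :: w) = sigma a y :: section a y w.
Proof. exact: section_funE. Qed.

Definition xmap_fun (O : set 'I_n) a (w : seq 'I_n) : seq 'I_n :=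
  if w is y :: w' then y :: (if y \in O then a w' else w') else [::].

Lemma xmap_subproof O a : is_tree_automorphism (xmap_fun O a).
Proof.
have [_ a0 ae] := autP a.
split=> //.
- exists (xmap_fun O (aut_inv a)); case=> [|y w] //=.
    by case yO: (y \in O); rewrite ?yO ?aut_invK.
  by case yO: (y \in O); rewrite ?yO ?autK_inv.
- case=> [|y u] [|z v] /=; first by [].
  + by rewrite !edge0 /=; case: ifP; rewrite ?size_aut.
  + by rewrite !edges0.
  + rewrite !edge_cons; case: eqP => //= <-; case: ifP => // _; exact: ae.
Qed.
(* a ^ x_O : trivial on the first level, coordinate a at each y in O and e
   elsewhere. *)
Definition xmap O a := Aut (xmap_subproof O a).

End AutGroup.

Section GroupNotions.
Variable T : groupType.

Definition subgroup (H : set T) : Prop :=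
  [/\ H 1, forall a b, H a -> H b -> H (a * b) & forall a, H a -> H a^-1].

Definition gen_subgroup (S : set T) : set T := smallest subgroup S.

Definition finitely_generated (H : set T) : Prop :=
  exists s : seq T, H = gen_subgroup [set` s].

Definition zexpg (x : T) (k : int) : T :=
  match k with Posz j => x ^+ j | Negz j => x ^- j.+1 end.

(* H is a free abelian group with a basis indexed by I: rank r for I = 'I_r,
   countably infinite rank for I = nat. *)
Definition free_abelian (I : eqType) (H : set T) : Prop :=
  (forall a b, H a -> H b -> commute a b) /\
  exists2 b : I -> T, H = gen_subgroup (range b) &
    forall (s : seq I) (k : I -> int), uniq s ->
      \prod_(i <- s) zexpg (b i) (k i) = 1 -> {in s, forall i, k i = 0%R}.

End GroupNotions.

Inductive states n : tree_aut n -> tree_aut n -> Prop :=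
| states_self a : states a a
| states_section a y b : states (section a y) b -> states a b.

Section SelfSimilar.
Variable n : nat.
Implicit Types G : set (tree_aut n).

Definition self_similar G : Prop :=
  subgroup G /\ forall a, G a -> states a `<=` G.

Definition orbit1 G (y : 'I_n) : set 'I_n := [set sigma a y | a in G].

Definition transitive1 G : Prop := forall y : 'I_n, orbit1 G y = setT.

(* The orbits are consecutive intervals of lengths given by ms;
   reshape_index ms y is the number of the interval containing y. *)
Definition orbit_type G (ms : seq nat) : Prop :=
  [/\ sumn ms = n, all (leq 1) ms &
    forall y z : 'I_n,
      orbit1 G y z <-> reshape_index ms y = reshape_index ms z].

(* The monoid gen_subgroup by the maps x_O, O ranging over the orbits of G.
   Maps compose on the right: (a ^ w) ^ x. *)
Inductive Delta_monoid G : (tree_aut n -> tree_aut n) -> Prop :=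
| Delta_id : Delta_monoid G id
| Delta_comp w y : Delta_monoid G w -> Delta_monoid G (xmap (orbit1 G y) \o w).

Definition Delta G : set (tree_aut n) :=
  gen_subgroup (\bigcup_(w in Delta_monoid G) (w @` G)).

End SelfSimilar.

(* The map f : G -> A_{m+1} extends the action of G on the words over the
   first m letters. *)
Definition extends_action m (G : set (tree_aut m)) (f : tree_aut m -> tree_aut m.+1) : Prop :=
  forall a, G a -> forall w : seq 'I_m,
    f a (map (widen_ord (leqnSn m)) w) = map (widen_ord (leqnSn m)) (a w).

(* Main.v *)
Require Import Defs.
From mathcomp Require Import all_boot all_order all_algebra perm.
From mathcomp Require Import boolp classical_sets.
From mathcomp Require Import zify.
Import GRing.Theory Num.Theory.

(* (i)(a) Self-similarity makes Delta(A) abelian.  If z lies outside the orbit of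
   y, and x, x' are the maps of the orbits of y and z, the elements
   a^{x' x^j} act as a below the vertex y^j z and trivially below the vertices
   y^i z with i <> j, hence are independent, while a finitely generated abelian
   group contains no infinite independent family.
   (i)(b) Extend A by a |-> (a_1, ..., a_m, e) sigma(a).  With x the map of the
   new orbit, the groups A^{x^j} act below distinct vertices, so they generate a
   direct sum of countably many copies of A, which is self-similar.
   (ii) Let Z^(N) act on the first m letters by an odometer driven by the first
   coordinate, so that the stabilizer of the first level has index m, and choose
   the sections so that they map this stabilizer isomorphically onto the square
   of the whole group; surjectivity gives Delta-invariance. *)

Set Implicit Arguments.
Unset Strict Implicit.
Unset Printing Implicit Defensive.

Local Open Scope classical_set_scope.
Local Open Scope group_scope.

(* A nonzero kernel vector over Q, with denominators cleared. *)
Lemma int_dependent N (M : nat -> nat -> int) :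
  exists2 v : nat -> int, exists2 j, j < N.+1 & v j <> 0%R &
    forall i, i < N -> (\sum_(0 <= j < N.+1) M j i * v j = 0)%R.
Proof.
pose A : 'M[rat]_(N.+1, N) := (\matrix_(j, i) (M j i)%:~R)%R.
(* [A] has one more row than columns, so its left kernel is nonzero. *)
have : kermx A != 0%R.
  by rewrite -mxrank_eq0 mxrank_ker subn_eq0 -ltnNge ltnS rank_leq_col.
case/matrix0Pn => p [q pq0].
pose u j := kermx A p j.
pose d := (\prod_j denq (u j))%R.
pose w j := (numq (u j) * \prod_(l | l != j) denq (u l))%R.
have wE j : ((w j)%:~R = u j * d%:~R)%R.
  rewrite /w /d [in RHS](bigD1 j) //= !rmorphM /= mulrA; congr (_ * _)%R.
  by rewrite numqE.
have d0 : (d != 0)%R by apply/prodf_neq0 => j _; rewrite denq_eq0.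
exists (fun j => w (inord j)).
  exists q => //; rewrite inord_val => w0; have := wE q; rewrite w0.
  by move/esym/eqP; rewrite mulf_eq0 intr_eq0 (negbTE pq0) (negbTE d0).
move=> i ltiN; rewrite big_mkord.
have /matrixP/(_ p (Ordinal ltiN)) := mulmx_ker A; rewrite !mxE => uM0.
apply/eqP; rewrite -(intr_eq0 rat) rmorph_sum /=; apply/eqP.
rewrite -[RHS](mul0r d%:~R%R) -[in RHS]uM0 mulr_suml; apply: eq_bigr => j _.
by rewrite rmorphM /= inord_val wE [A _ _]mxE mulrA [(_ * u j)%R]mulrC mulrAC.
Qed.

(** * Generated subgroups and integer combinations *)

Section Groups.
Variable T : groupType.
Implicit Types (S H : set T) (x y : T).

Lemma gen_subgroupP S : subgroup (gen_subgroup S).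
Proof.
split; first by move=> H [[]].
  by move=> a b Sa Sb H HS; have [[_ HM _] _] := HS; apply: HM; [apply: Sa | apply: Sb].
by move=> a Sa H HS; have [[_ _ HV] _] := HS; apply: HV; apply: Sa.
Qed.

Lemma mem_gen_subgroup S : S `<=` gen_subgroup S.
Proof. exact: sub_gen_smallest. Qed.

Lemma gen_subgroup_min S H : subgroup H -> S `<=` H -> gen_subgroup S `<=` H.
Proof. exact: smallest_sub. Qed.

(** Centralizers are subgroups: this extends commutation from generators in one argument, then in
    the other. *)
Lemma gen_subgroup_commute S :
  (forall x y, S x -> S y -> commute x y) ->
  forall x y, gen_subgroup S x -> gen_subgroup S y -> commute x y.
Proof.
have cent H : subgroup [set x | forall y, H y -> commute y x].
  split=> [y _|a b Ha Hb y Hy|a Ha y Hy]; first exact: commute1.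
    by apply: commuteM; [apply: Ha | apply: Hb].
  by apply: commuteV; apply: Ha.
move=> cS x y Sx Sy; apply: (gen_subgroup_min (cent _) _ Sy) Sx => z Sz u Su.
apply: commute_sym; apply: (gen_subgroup_min (cent S) _ Su) Sz => v Sv w Sw.
exact: cS.
Qed.

Lemma zexpg0 x : zexpg x 0%R = 1. Proof. by []. Qed.

Lemma zexpg1n (k : int) : zexpg (1 : T) k = 1.
Proof. by case: k => k /=; rewrite ?(expg1n _ k.+1) ?expg1n ?invg1. Qed.

Lemma zexpgDr x (k l : int) : zexpg x (k + l)%R = zexpg x k * zexpg x l.
Proof.
have step j : zexpg x (j + 1)%R = zexpg x j * x.
  case: j => [j|[|j]].
  - by rewrite /= addn1 expgSr.
  - by rewrite /= mulVg.
  - rewrite (_ : (Negz j.+1 + 1)%R = Negz j) /=; last by lia.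
    by rewrite [in RHS]expgS invgM mulgVK.
have step' j : zexpg x (j - 1)%R = zexpg x j * x^-1.
  by rewrite -{2}(GRing.subrK 1%R j) step mulgK.
elim: l => [|l IHl|l IHl]; first by rewrite GRing.addr0 zexpg0 mulg1.
  by rewrite (_ : (k + l.+1%:Z = k + l%:Z + 1)%R) ?step ?IHl -?mulgA -?step -?PoszD ?addn1 //; lia.
rewrite (_ : (k - l.+1%:Z = k - l%:Z - 1)%R) ?step' ?IHl -?mulgA -?step'; last by lia.
by congr (_ * zexpg x _); lia.
Qed.

Lemma commute_zexpg x y (k l : int) : commute x y -> commute (zexpg x k) (zexpg y l).
Proof.
have cz z t j : commute z t -> commute z (zexpg t j).
  move=> czt; case: j => j /=; first exact: commuteX.
  by apply: commuteV; apply: (commuteX j.+1).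
by move=> cxy; apply/cz/commute_sym/cz/commute_sym.
Qed.

Section Commuting.
Variable b : nat -> T.
Hypothesis bC : forall i j, commute (b i) (b j).

Definition lincomb N (k : nat -> int) := \prod_(0 <= i < N) zexpg (b i) (k i).

Lemma lincombD N k l :
  lincomb N (fun i => k i + l i)%R = lincomb N k * lincomb N l.
Proof.
rewrite /lincomb -prodgM_commute; first by apply: eq_bigr => i _; rewrite zexpgDr.
by move=> i j *; apply: commute_zexpg.
Qed.

Lemma lincomb0 N : lincomb N (fun=> 0%R) = 1.
Proof. by rewrite /lincomb big1. Qed.

Lemma lincombN N k : lincomb N (fun i => - k i)%R = (lincomb N k)^-1.
Proof.
apply: (mulgI (lincomb N k)); rewrite -lincombD mulgV -(lincomb0 N).
by congr lincomb; apply/funext => i; rewrite subrr.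
Qed.

Lemma lincombZ N k (v : int) : lincomb N (fun i => k i * v)%R = zexpg (lincomb N k) v.
Proof.
have nat_case j : lincomb N (fun i => k i * j%:Z)%R = lincomb N k ^+ j.
  elim: j => [|j IHj].
    by rewrite -[RHS](lincomb0 N); congr lincomb; apply/funext => i; rewrite mulr0.
  rewrite expgS -IHj -lincombD; congr lincomb; apply/funext => i; lia.
case: v => v //=; rewrite -(nat_case v.+1) -lincombN; congr lincomb.
by apply/funext => i; lia.
Qed.

Lemma lincomb_delta N i : i < N -> lincomb N (fun j => (j == i)%:R%R) = b i.
Proof.
elim: N => // N IHN; rewrite ltnS leq_eqVlt /lincomb big_nat_recr //= => /predU1P[->|ltiN].
  rewrite big_nat big1 ?mul1g ?eqxx // => j /andP[_ ltjN].
  by rewrite (ltn_eqF ltjN).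
by rewrite -[X in _ = X]mulg1 -[in RHS](IHN ltiN) gtn_eqF.
Qed.

Lemma lincomb_widen N M k : (forall i, N <= i -> k i = 0%R) -> N <= M ->
  lincomb M k = lincomb N k.
Proof.
move=> k0 leNM; rewrite /lincomb (big_cat_nat (leq0n N) leNM) /=.
rewrite [X in _ * X]big_nat [X in _ * X]big1 ?mulg1 // => i /andP[leNi _].
by rewrite k0.
Qed.

Lemma lincomb_subgroup N : subgroup [set lincomb N k | k in setT].
Proof.
split.
- by exists (fun=> 0%R) => //; apply: lincomb0.
- by move=> _ _ [k _ <-] [l _ <-]; rewrite -lincombD; eexists.
- by move=> _ [k _ <-]; rewrite -lincombN; eexists.
Qed.

End Commuting.

(** Over [d] generators, [d + 1] elements have coefficient vectors in [Z^d], and these are linearly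
    dependent. *)
Lemma fg_abelian_dependent H (x : nat -> T) :
  finitely_generated H -> (forall a b, H a -> H b -> commute a b) ->
  (forall i, H (x i)) ->
  exists N, exists2 v : nat -> int, exists2 j, j < N & v j <> 0%R &
    \prod_(0 <= j < N) zexpg (x j) (v j) = 1.
Proof.
move=> [s HE] cH Hx.
(* Padding the generators by the default 1 gives a family indexed by [nat] that stays inside [H]. *)
have Hs i : H (nth 1 s i).
  have [lt_is|le_si] := ltnP i (size s).
    by rewrite HE; apply: mem_gen_subgroup; apply: mem_nth.
  by rewrite nth_default // HE; have [] := gen_subgroupP [set` s].
have bC i j : commute (nth 1 s i) (nth 1 s j) by apply: cH.
have xM i : exists k, lincomb (nth 1 s) (size s) k = x i.
  have: [set lincomb (nth 1 s) (size s) k | k in setT] (x i).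
    move: (Hx i); rewrite {1}HE; apply: gen_subgroup_min; first exact: lincomb_subgroup.
    move=> y /= sy; exists (fun j => (j == index y s)%:R%R) => //.
    by rewrite lincomb_delta ?index_mem // nth_index.
  by case=> k _; exists k.
pose M i := projT1 (cid (xM i)).
have ME i : lincomb (nth 1 s) (size s) (M i) = x i by rewrite /M; case: (cid _).
have [v v0 vM] := int_dependent (size s) M.
exists (size s).+1; exists v => //; clear v0.
transitivity (lincomb (nth 1 s) (size s)
  (fun i => \sum_(0 <= j < (size s).+1) M j i * v j)%R).
  elim: (size s).+1 => [|N IHN].
    rewrite big_geq // -[LHS](lincomb0 (nth 1 s) (size s)); congr lincomb.
    by apply/funext => i; rewrite big_geq.
  rewrite big_nat_recr //= IHN -ME -lincombZ // -lincombD //; congr lincomb.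
  by apply/funext => i; rewrite big_nat_recr.
rewrite /lincomb big_nat big1 // => i /andP[_ ltis].
by rewrite vM.
Qed.

End Groups.

(** * The wreath recursion, first-level orbits and [Delta] *)

Section Trees.
Variable n : nat.
Implicit Types (a b c : tree_aut n) (G : set (tree_aut n)) (y z : 'I_n).

Lemma sigmaM a b y : sigma (a * b) y = sigma b (sigma a y).
Proof.
have := aut_cons (a * b) y [::].
by rewrite -[LHS]/(b (a [:: y])) !aut_cons => -[].
Qed.

Lemma sectionM a b y : section (a * b) y = section a y * section b (sigma a y).
Proof.
apply: autE => w; have := aut_cons (a * b) y w.
by rewrite -[LHS]/(b (a (y :: w))) !aut_cons => -[].
Qed.

Lemma sigma1 y : sigma (1 : tree_aut n) y = y.
Proof. by have := aut_cons (1 : tree_aut n) y [::] => -[]. Qed.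

Lemma section1 y : section (1 : tree_aut n) y = 1.
Proof. by apply: autE => w; have := aut_cons (1 : tree_aut n) y w => -[]. Qed.

Lemma sectionV a y : section a^-1 y = (section a (sigma a^-1 y))^-1.
Proof.
apply: (mulIg (section a (sigma a^-1 y))).
by rewrite -sectionM !mulVg section1.
Qed.

Lemma tree_aut_eq a b :
  (forall y, sigma a y = sigma b y) -> (forall y, section a y = section b y) -> a = b.
Proof.
move=> ab_sigma ab_section; apply: autE => -[|y w].
  by case: (autP a) => _ -> _; case: (autP b) => _ ->.
by rewrite !aut_cons ab_sigma ab_section.
Qed.

Lemma self_similar_closed G : subgroup G ->
  (forall a y, G a -> G (section a y)) -> self_similar G.
Proof.
move=> sG GS; split=> // a Ga b ab; elim: ab Ga => // {}a y {}b _ IH Ga.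
exact/IH/GS.
Qed.

Lemma self_similar_section G a y : self_similar G -> G a -> G (section a y).
Proof. by move=> [_ GS] /GS; apply; apply: states_section (states_self _). Qed.

(** Sections of products and inverses are products and inverses of sections, so the elements whose
    sections all lie in the generated subgroup form a subgroup. *)
Lemma section_closed_gen (S : set (tree_aut n)) :
  (forall a y, S a -> gen_subgroup S (section a y)) ->
  self_similar (gen_subgroup S).
Proof.
move=> SS; have [S1 SM SV] := gen_subgroupP S.
apply: self_similar_closed => [|a y Sa]; first exact: gen_subgroupP.
suff: gen_subgroup S `<=` [set a | forall y, gen_subgroup S (section a y)] by apply.
apply: gen_subgroup_min => [|b Sb z]; last exact: SS.
split=> [z|b c Sb Sc z|b Sb z]; rewrite ?section1 ?sectionM ?sectionV //.
  by apply: SM.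
by apply: SV.
Qed.

Lemma xmap_in (O : set 'I_n) a y w : O y -> xmap O a (y :: w) = y :: a w.
Proof. by move=> Oy /=; rewrite mem_set. Qed.

Lemma xmap_out (O : set 'I_n) a y w : ~ O y -> xmap O a (y :: w) = y :: w.
Proof. by move=> Oy /=; rewrite memNset. Qed.

Lemma sigma_xmap (O : set 'I_n) a y : sigma (xmap O a) y = y.
Proof. by have := aut_cons (xmap O a) y [::] => -[]. Qed.

Lemma section_xmap_in (O : set 'I_n) a y : O y -> section (xmap O a) y = a.
Proof.
by move=> Oy; apply: autE => w; have := aut_cons (xmap O a) y w; rewrite xmap_in // => -[].
Qed.

Lemma section_xmap_out (O : set 'I_n) a y : ~ O y -> section (xmap O a) y = 1.
Proof.
by move=> Oy; apply: autE => w; have := aut_cons (xmap O a) y w; rewrite xmap_out // => -[].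
Qed.

Lemma orbit1_refl G y : subgroup G -> orbit1 G y y.
Proof. by move=> [G1 _ _]; exists 1; rewrite ?sigma1. Qed.

Lemma orbit1_sigma G a y z : subgroup G -> G a ->
  orbit1 G y (sigma a z) <-> orbit1 G y z.
Proof.
move=> [_ GM GV] Ga; split=> -[b Gb byz].
  exists (b * a^-1); first by apply: GM => //; apply: GV.
  by rewrite sigmaM byz -sigmaM mulgV sigma1.
by exists (b * a); [apply: GM | rewrite sigmaM byz].
Qed.

Lemma orbit1_sym G y z : subgroup G -> orbit1 G y z -> orbit1 G z y.
Proof.
move=> sG [a Ga <-]; have [_ _ GV] := sG.
exists a^-1; first exact: GV.
by rewrite -sigmaM mulgV sigma1.
Qed.

Lemma commute_xmap (O P : set 'I_n) a b :
  commute a b -> commute (xmap O a) (xmap P b).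
Proof.
move=> cab; apply: tree_aut_eq => y; first by rewrite !sigmaM !sigma_xmap.
rewrite !sectionM !sigma_xmap.
have [Oy|nOy] := pselect (O y); have [Py|nPy] := pselect (P y);
  by rewrite ?(section_xmap_in _ Oy) ?(section_xmap_out _ nOy)
    ?(section_xmap_in _ Py) ?(section_xmap_out _ nPy) ?mulg1 ?mul1g.
Qed.

Section DeltaCommutative.
Variable G : set (tree_aut n).
Hypotheses (ssG : self_similar G)
  (cG : forall a b, G a -> G b -> commute a b).

(** Two maps [xmap O] and [xmap P] preserve commutation coordinatewise, so one map is peeled off
    each word until one word is empty; that case is [base]. *)
Lemma Delta_monoid_commute f g a b : Delta_monoid G f -> Delta_monoid G g ->
  G a -> G b -> commute (f a) (g b).
Proof.
have [sG _] := ssG.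
(* As [c] preserves each orbit, [z] and its image both carry [h d] or both carry 1; it remains that
   the section of [c], in [G] by self-similarity, commutes with [h d]. *)
have base h : Delta_monoid G h -> forall c d, G c -> G d -> commute c (h d).
  elim=> {h} [|h y _ IH] c d Gc Gd; first exact: cG.
  apply: tree_aut_eq => z; rewrite ?sigmaM ?sectionM !sigma_xmap //.
  have [Oz|nOz] := pselect (orbit1 G y z).
    rewrite section_xmap_in; last exact/(orbit1_sigma _ _ sG Gc).
    by rewrite section_xmap_in //; apply: IH => //; apply: self_similar_section.
  rewrite section_xmap_out ?mulg1; last by move/(orbit1_sigma _ _ sG Gc).
  by rewrite section_xmap_out ?mul1g.
move=> Df Dg Ga Gb; elim: Df g Dg => [|{}f y Df IH] g Dg; first exact: base.
case: Dg => [|{}g z Dg] /=; last by apply: commute_xmap; apply: IH.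
by apply/commute_sym/(base (xmap (orbit1 G y) \o f)) => //; apply: Delta_comp.
Qed.

Lemma Delta_commute a b : Delta G a -> Delta G b -> commute a b.
Proof.
apply: gen_subgroup_commute => _ _ [f Df [c Gc <-]] [g Dg [d Gd <-]].
exact: Delta_monoid_commute.
Qed.

End DeltaCommutative.

Lemma Delta_monoid_iter G f y j :
  Delta_monoid G f -> Delta_monoid G (iter j (xmap (orbit1 G y)) \o f).
Proof. by move=> Df; elim: j => // j IHj; apply: (Delta_comp y IHj). Qed.

Lemma Delta_mem G f a : Delta_monoid G f -> G a -> Delta G (f a).
Proof. by move=> Df Ga; apply: mem_gen_subgroup; exists f => //; exists a. Qed.

End Trees.

(** * Action on the subtree below a vertex *)

Section ActsBelow.
Variables (m n : nat) (u : seq 'I_n) (h : 'I_m -> 'I_n).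

(** The map [h] embeds a possibly smaller alphabet; it is the identity in the non-transitive case
    and [lift ord_max] for the extension. *)
Definition acts_below (a : tree_aut n) (c : tree_aut m) :=
  forall w, a (u ++ map h w) = u ++ map h (c w).

Lemma acts_belowM a b c d :
  acts_below a c -> acts_below b d -> acts_below (a * b) (c * d).
Proof. by move=> ac bd w; rewrite -[LHS]/(b (a _)) ac bd. Qed.

Lemma acts_belowV a c : acts_below a c -> acts_below a^-1 c^-1.
Proof.
move=> ac w; apply: (can_inj (aut_invK a)).
rewrite ac -[LHS]/((a^-1 * a) (u ++ map h w)) mulVg.
by rewrite -[c _]/((c^-1 * c) w) mulVg.
Qed.

Lemma acts_below_zexpg a c k : acts_below a c -> acts_below (zexpg a k) (zexpg c k).
Proof.
move=> ac; have acX j : acts_below (a ^+ j) (c ^+ j).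
  by elim: j => // j IHj; rewrite !expgS; apply: acts_belowM.
by case: k => k //=; apply: acts_belowV; apply: (acX k.+1).
Qed.

Lemma acts_below_prod (I : Type) (s : seq I) (F : I -> tree_aut n) (H : I -> tree_aut m) k :
  (forall i, acts_below (F i) (H i)) ->
  acts_below (\prod_(i <- s) zexpg (F i) (k i)) (\prod_(i <- s) zexpg (H i) (k i)).
Proof.
move=> FH; elim: s => [|i s IHs]; first by rewrite !big_nil.
by rewrite !big_cons; apply: acts_belowM => //; apply: acts_below_zexpg.
Qed.

Lemma acts_below_eq1 c : injective h -> acts_below 1 c -> c = 1.
Proof.
move=> h_inj c1; apply: autE => w; apply: (inj_map h_inj).
by have /eqP := c1 w; rewrite eqseq_cat // eqxx => /eqP /esym.
Qed.

End ActsBelow.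

(** * Non-transitive groups: [Delta] is not finitely generated *)

Section NotFinitelyGenerated.
Variable n : nat.

(** Each letter [y] strips one [xmap O]. If [j < i], then [xmap P a] meets [y], outside [P]; if
    [j > i], then [xmap O] meets [z], outside [O]; only for [j = i] does [xmap P a] meet [z]. *)
Lemma acts_below_iter_xmap (O P : set 'I_n) y z (a : tree_aut n) i j :
  O y -> ~ O z -> P z -> ~ P y ->
  acts_below (rcons (nseq i y) z) id (iter j (xmap O) (xmap P a))
    (if j == i then a else 1).
Proof.
move=> Oy nOz Pz nPy; elim: i j => [|i IHi] [|j] w; rewrite !map_id.
- exact: xmap_in.
- exact: xmap_out.
- exact: xmap_out.
- have := IHi j w; rewrite !map_id eqSS /= => {}IHi.
  by rewrite mem_set // IHi.
Qed.

Lemma Delta_not_fg r (A : set (tree_aut n)) : 0 < r ->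
  free_abelian 'I_r A -> self_similar A -> ~ transitive1 A ->
  ~ finitely_generated (Delta A).
Proof.
case: r => // r _ [cA [b AE bfree]] ssA /existsNP[y ntrA] fgD.
have [sA _] := ssA.
have [z nOz] : exists z, ~ orbit1 A y z.
  apply/existsNP => Oy; apply: ntrA; apply/seteqP; split=> // z _; exact: Oy.
have Aa : A (b ord0) by rewrite AE; apply: mem_gen_subgroup; exists ord0.
pose x j := iter j (xmap (orbit1 A y)) (xmap (orbit1 A z) (b ord0)).
have xD j : Delta A (x j).
  exact: (Delta_mem (Delta_monoid_iter y j (Delta_comp z (Delta_id A)))).
have [N [v [i ltiN vi0] v1]] := fg_abelian_dependent fgD (Delta_commute ssA cA) xD.
apply: vi0.
(* Below [y^i z] only the [i]-th factor of the relation survives, so [b ord0] to the power [v i] is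
   1, and freeness gives [v i = 0]. *)
have := @acts_below_prod n n (rcons (nseq i y) z) id nat (index_iota 0 N) _ _ v
  (fun j => acts_below_iter_xmap (b ord0) i j (orbit1_refl y sA) nOz
    (orbit1_refl z sA) (fun Oz => nOz (orbit1_sym sA Oz))).
rewrite v1 => /(acts_below_eq1 (@inj_id _)).
rewrite (eq_bigr (fun j => if j == i then zexpg (b ord0) (v j) else 1)); last first.
  by move=> j _; case: eqP => // _; apply: zexpg1n.
rewrite -big_mkcond big_nat1_eq ltiN /= => ai1.
apply: (bfree [:: ord0] (fun=> v i)) (mem_head _ _) => //.
by rewrite big_seq1.
Qed.

End NotFinitelyGenerated.

(** * Automorphisms defined by automata *)

Section Automaton.
Variables (n : nat) (Q : Type) (act : Q -> {perm 'I_n}) (next : Q -> 'I_n -> Q).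

(** Wreath recursions become automata over an arbitrary, possibly infinite type of states: below,
    all tree automorphisms or all integer sequences. *)
Fixpoint run (q : Q) (w : seq 'I_n) : seq 'I_n :=
  if w is y :: w' then act q y :: run (next q y) w' else [::].

Fixpoint unrun (q : Q) (w : seq 'I_n) : seq 'I_n :=
  if w is z :: w' then
    let y := (act q)^-1%g z in y :: unrun (next q y) w'
  else [::].

Lemma size_run q w : size (run q w) = size w.
Proof. by elim: w q => //= y w IHw q; rewrite IHw. Qed.

Lemma run_subproof q : is_tree_automorphism (run q).
Proof.
split=> //.
- exists (unrun q) => w; elim: w q => //= y w IHw q; first by rewrite permK IHw.
  by rewrite permKV IHw.
- move=> u v; elim: u v q => [|y u IHu] [|z v] q //=.
  + by rewrite !edge0 /= size_run.
  + by rewrite !edge_cons (inj_eq perm_inj); case: eqP => //= ->; apply: IHu.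
Qed.

Definition automaton_aut q := Aut (run_subproof q).

Lemma sigma_automaton q y : sigma (automaton_aut q) y = act q y.
Proof. by have := aut_cons (automaton_aut q) y [::] => -[]. Qed.

Lemma section_automaton q y : section (automaton_aut q) y = automaton_aut (next q y).
Proof. by apply: autE => w; have := aut_cons (automaton_aut q) y w => -[]. Qed.

Lemma automaton_autM (op : Q -> Q -> Q) :
  (forall p q y, act (op p q) y = act q (act p y)) ->
  (forall p q y, next (op p q) y = op (next p y) (next q (act p y))) ->
  {morph automaton_aut : p q / op p q >-> p * q}.
Proof.
move=> actM nextM p q; apply: autE => w; rewrite -[RHS]/(run q (run p w)) /=.
by elim: w p q => //= y w IHw p q; rewrite actM nextM IHw.
Qed.

End Automaton.

(** * Groups of orbit type [(m,1)] *)

Section LastLetterFixed.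
Variables (m : nat) (G : set (tree_aut m.+1)).
Hypotheses (sG : subgroup G)
  (fixG : forall a, G a -> sigma a ord_max = ord_max)
  (trG : forall i j : 'I_m,
     exists2 a, G a & sigma a (lift ord_max i) = lift ord_max j).

Lemma orbit1_last : orbit1 G ord_max = [set ord_max].
Proof.
apply/seteqP; split=> [_ [a Ga <-]|_ ->]; first exact: fixG.
exact: orbit1_refl.
Qed.

Lemma orbit1_lift (i : 'I_m) : orbit1 G (lift ord_max i) = [set~ ord_max].
Proof.
apply/seteqP; split=> [_ [a Ga <-]|y].
  rewrite /= -[X in _ = X](fixG Ga) => /perm_inj /eqP.
  by rewrite eq_sym (negbTE (neq_lift _ _)).
case: (unliftP ord_max y) => [j -> _|-> //]; last by case.
by have [a Ga <-] := trG i j; exists a.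
Qed.

Lemma orbit_type_last : 0 < m -> orbit_type G [:: m; 1%N].
Proof.
move=> m_gt0; split=> [||y z]; first by rewrite /= addn0 addn1.
  by rewrite /= m_gt0.
(* The second interval is the last letter alone; the boolean is read as the interval number. *)
have idx (t : 'I_m.+1) : reshape_index [:: m; 1%N] t = (t == ord_max).
  rewrite /reshape_index /= subn_eq0; case: (unliftP ord_max t) => [j ->|->].
    by rewrite lift_max ltn_ord eq_sym (negbTE (neq_lift _ _)).
  by rewrite /= ltnn eqxx subSnn subnn.
rewrite !idx; case: (unliftP ord_max y) => [i ->|->].
  rewrite orbit1_lift /= [lift _ _ == _]eq_sym (negbTE (neq_lift _ _)).
  by case: eqP.
by rewrite orbit1_last /= eqxx; case: eqP.
Qed.

Lemma not_transitive1_last : 0 < m -> ~ transitive1 G.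
Proof.
move=> m_gt0 /(_ ord_max); rewrite orbit1_last => /seteqP[_].
move=> /(_ (lift ord_max (Ordinal m_gt0)) I) /= /eqP.
by rewrite eq_sym (negbTE (neq_lift _ _)).
Qed.

End LastLetterFixed.

(** [extends_action] is phrased with the first embedding of the letters, the constructions with the
    second. *)
Lemma widen_lift m (i : 'I_m) : widen_ord (leqnSn m) i = lift ord_max i.
Proof. by apply: val_inj; rewrite /= /bump leqNgt ltn_ord. Qed.

(** * Extension of a transitive group by a fixed letter *)

Section Extension.
Variable m : nat.
Implicit Types a b : tree_aut m.

Definition extend_next a (y : 'I_m.+1) : tree_aut m :=
  if unlift ord_max y is Some i then section a i else 1.

(* a |-> (a_1, ..., a_m, e) sigma(a), coordinatewise and recursively. *)
Definition extend : tree_aut m -> tree_aut m.+1 :=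
  automaton_aut (fun a => lift_perm ord_max ord_max (sigma a)) extend_next.

Lemma sigma_extend_last a : sigma (extend a) ord_max = ord_max.
Proof. by rewrite sigma_automaton lift_perm_id. Qed.

Lemma sigma_extend_lift a i :
  sigma (extend a) (lift ord_max i) = lift ord_max (sigma a i).
Proof. by rewrite sigma_automaton lift_perm_lift. Qed.

Lemma section_extend a y : section (extend a) y = extend (extend_next a y).
Proof. exact: section_automaton. Qed.

Lemma extendM : {morph extend : a b / a * b}.
Proof.
apply: automaton_autM => a b y; rewrite /extend_next.
  case: (unliftP ord_max y) => [i ->|->]; last by rewrite !lift_perm_id.
  by rewrite !lift_perm_lift sigmaM.
case: (unliftP ord_max y) => [i ->|->]; first by rewrite lift_perm_lift liftK sectionM.
by rewrite lift_perm_id unlift_none mul1g.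
Qed.

Lemma extend1 : extend 1 = 1.
Proof. by apply: (mulgI (extend 1)); rewrite -extendM !mulg1. Qed.

Lemma extendV a : extend a^-1 = (extend a)^-1.
Proof. by apply: (mulgI (extend a)); rewrite -extendM !mulgV extend1. Qed.

Lemma extend_lift a w : extend a (map (lift ord_max) w) = map (lift ord_max) (a w).
Proof.
elim: w a => [|i w IHw] a; first by case: (autP a) => _ ->.
rewrite map_cons !aut_cons map_cons sigma_extend_lift section_extend.
by rewrite /extend_next liftK IHw.
Qed.

Lemma extend_last a w : extend a (ord_max :: w) = ord_max :: w.
Proof.
rewrite aut_cons sigma_extend_last section_extend /extend_next unlift_none.
by rewrite extend1.
Qed.

Lemma extend_subgroup (A : set (tree_aut m)) : subgroup A -> subgroup (extend @` A).
Proof.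
move=> [A1 AM AV]; split.
- by exists 1; rewrite ?extend1.
- by move=> _ _ [a Aa <-] [b Ab <-]; rewrite -extendM; exists (a * b) => //; apply: AM.
- by move=> _ [a Aa <-]; rewrite -extendV; exists a^-1 => //; apply: AV.
Qed.

Lemma extend_self_similar (A : set (tree_aut m)) :
  self_similar A -> self_similar (extend @` A).
Proof.
move=> ssA; have [sA _] := ssA; have [A1 _ _] := sA.
apply: self_similar_closed => [|_ y [a Aa <-]]; first exact: extend_subgroup.
rewrite section_extend; eexists; last by [].
by rewrite /extend_next; case: unlift => // i; apply: self_similar_section.
Qed.

Section Transitive.
Variables (r : nat) (A : set (tree_aut m)) (b : 'I_r.+1 -> tree_aut m).
Hypotheses (m_gt0 : 0 < m) (ssA : self_similar A) (trA : transitive1 A)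
  (cA : forall a c, A a -> A c -> commute a c)
  (AE : A = gen_subgroup (range b))
  (b_free : forall (s : seq 'I_r.+1) (k : 'I_r.+1 -> int), uniq s ->
      \prod_(i <- s) zexpg (b i) (k i) = 1 -> {in s, forall i, k i = 0%R}).

Let G := extend @` A.

Lemma extend_fix (g : tree_aut m.+1) : G g -> sigma g ord_max = ord_max.
Proof. by case=> a _ <-; apply: sigma_extend_last. Qed.

Lemma extend_transitive (i j : 'I_m) :
  exists2 g, G g & sigma g (lift ord_max i) = lift ord_max j.
Proof.
have : orbit1 A i j by rewrite trA.
by case=> a Aa <-; exists (extend a); [exists a | apply: sigma_extend_lift].
Qed.

(** By division with remainder [nat] enumerates pairs of a level and a basis index:
    [k = j * r.+1 + c] stands for the extension of [b c] moved below [ord_max^j]. *)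
Definition last_basis k : tree_aut m.+1 :=
  iter (k %/ r.+1) (xmap [set ord_max]) (extend (b (inord (k %% r.+1)))).

(** Words over the old letters below [ord_max^i] see level [i] only: a generator of higher level is
    trivial at old letters, and an extension fixes every word starting with [ord_max]. *)
Lemma acts_below_last_basis i k :
  acts_below (nseq i ord_max) (lift ord_max) (last_basis k)
    (if k %/ r.+1 == i then b (inord (k %% r.+1)) else 1).
Proof.
rewrite /last_basis; move: (k %/ r.+1) (b _) => j a.
elim: i j => [|i IHi] [|j] w.
- exact: extend_lift.
- case: w => //= y w; rewrite memNset //= => /eqP.
  by rewrite eq_sym (negbTE (neq_lift _ _)).
- exact: extend_last.
- by rewrite /= mem_set //= eqSS -IHi.
Qed.

(** Restricting a relation to the subtree at [ord_max^i] keeps the factors of level [i]; their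
    indices have distinct residues, so this is a relation among distinct [b c]. *)
Lemma last_basis_free (s : seq nat) (k : nat -> int) : uniq s ->
  \prod_(j <- s) zexpg (last_basis j) (k j) = 1 -> {in s, forall j, k j = 0%R}.
Proof.
move=> s_uniq bk1 l ls; pose i := l %/ r.+1.
have divr j : j = j %/ r.+1 * r.+1 + (inord (j %% r.+1) : 'I_r.+1).
  by rewrite inordK ?ltn_mod // -divn_eq.
have := acts_below_prod s k (acts_below_last_basis i); rewrite bk1.
move=> /(acts_below_eq1 lift_inj).
rewrite (eq_bigr (fun j => if j %/ r.+1 == i then
  zexpg (b (inord (j %% r.+1))) (k (i * r.+1 + (inord (j %% r.+1) : 'I_r.+1))) else 1)).
  rewrite -big_mkcond -big_filter -(big_map (fun j => inord (j %% r.+1) : 'I_r.+1) xpredT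
    (fun c => zexpg (b c) (k (i * r.+1 + c)))) => /b_free free0.
  rewrite {1}(divr l); apply: free0.
    rewrite map_inj_in_uniq ?filter_uniq // => x y.
    rewrite !mem_filter => /andP[/eqP xi _] /andP[/eqP yi _] xy.
    by rewrite (divr x) (divr y) xi yi xy.
  by apply/mapP; exists l => //; rewrite mem_filter eqxx.
by move=> j _; case: eqP => [<-|_]; rewrite -?divr ?zexpg1n.
Qed.

Lemma last_basis_Delta k : Delta G (last_basis k).
Proof.
have [sA _] := ssA.
rewrite /last_basis -(orbit1_last (extend_subgroup sA) extend_fix).
apply: (Delta_mem (Delta_monoid_iter ord_max _ (Delta_id G))).
by exists (b (inord (k %% r.+1))) => //; rewrite AE; apply: mem_gen_subgroup; eexists.
Qed.

Lemma last_basis_sub_Delta : gen_subgroup (range last_basis) `<=` Delta G.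
Proof.
apply: gen_subgroup_min; first exact: gen_subgroupP.
by move=> _ [k _ <-]; apply: last_basis_Delta.
Qed.

Lemma extend_in_last_basis a : A a -> gen_subgroup (range last_basis) (extend a).
Proof.
have [B1 BM BV] := gen_subgroupP (range last_basis).
rewrite {1}AE; apply: (@gen_subgroup_min _ _
  [set a | gen_subgroup (range last_basis) (extend a)]).
  split=> [|x y Bx By|x Bx] /=; rewrite ?extend1 ?extendM ?extendV //.
    exact: BM.
  exact: BV.
move=> _ [i _ <-]; apply: mem_gen_subgroup; exists (i : nat) => //.
by rewrite /last_basis divn_small // modn_small // inord_val.
Qed.

(** The section at [ord_max] lowers a positive level by one and the other sections there are
    trivial; at level 0 the sections are extensions of elements of [A]. *)
Lemma last_basis_self_similar : self_similar (gen_subgroup (range last_basis)).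
Proof.
have [B1 _ _] := gen_subgroupP (range last_basis).
apply: section_closed_gen => _ y [k _ <-]; rewrite /last_basis.
case kE: (k %/ r.+1) => [|j] /=.
  rewrite section_extend; apply: extend_in_last_basis.
  have [[A1 _ _] _] := ssA; rewrite /extend_next; case: unlift => // i.
  apply: self_similar_section => //.
  by rewrite AE; apply: mem_gen_subgroup; eexists.
have [->|y_neq] := pselect (y = ord_max); last by rewrite section_xmap_out.
rewrite section_xmap_in //; apply: mem_gen_subgroup.
(* This index is [k - r.+1]. *)
exists (j * r.+1 + k %% r.+1) => //.
by rewrite /last_basis divnMDl // modnMDl modn_mod divn_small ?ltn_mod // addn0.
Qed.

Lemma last_basis_free_abelian : free_abelian nat (gen_subgroup (range last_basis)).
Proof.
split; last by exists last_basis => //; apply: last_basis_free.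
have cG x y : G x -> G y -> commute x y.
  by move=> [a Aa <-] [c Ac <-]; rewrite /commute -!extendM cA.
move=> x y /last_basis_sub_Delta Dx /last_basis_sub_Delta Dy.
exact: (Delta_commute (extend_self_similar ssA) cG).
Qed.

End Transitive.
End Extension.

Lemma transitive_extension m r (A : set (tree_aut m)) : (1 < m)%N ->
  free_abelian 'I_r A -> self_similar A -> transitive1 A ->
  exists f : tree_aut m -> tree_aut m.+1,
    [/\ {in A &, {morph f : a b / a * b}},
        extends_action A f,
        self_similar (f @` A) /\ ~ transitive1 (f @` A),
        orbit_type (f @` A) [:: m; 1%N] &
        exists B : set (tree_aut m.+1),
          [/\ B `<=` Delta (f @` A), self_similar B & free_abelian nat B]].
Proof.
move=> m_gt1 [cA [b AE b_free]] ssA trA; have m_gt0 := ltnW m_gt1.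
have [sA _] := ssA.
(* In rank 0 the group is trivial, which contradicts transitivity on at least two letters. *)
case: r => [|r] in b AE b_free *.
  have A1 a : A a -> a = 1.
    rewrite AE; apply: (@gen_subgroup_min _ _ [set 1]) => [|_ [[]]//].
    by split=> [|_ _ -> ->|_ ->]; rewrite ?mulg1 ?invg1.
  have : orbit1 A (Ordinal m_gt0) (Ordinal m_gt1) by rewrite trA.
  by case=> a /A1 ->; rewrite sigma1.
have sE := extend_subgroup sA.
exists (@extend m); split.
- by move=> a c _ _; apply: extendM.
- by move=> a _ w; rewrite !(eq_map (@widen_lift m)) extend_lift.
- split; first exact: extend_self_similar.
  exact: (not_transitive1_last sE (@extend_fix _ A)).
- exact: (orbit_type_last sE (@extend_fix _ A) (extend_transitive trA)).
- exists (gen_subgroup (range (last_basis b))); split.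
  + exact: last_basis_sub_Delta.
  + exact: (last_basis_self_similar ssA AE).
  + exact: (last_basis_free_abelian ssA cA AE).
Qed.

(** * The odometer group *)

Section FreeOdometer.
Variable m : nat.
Implicit Types (i : 'I_m) (y : 'I_m.+1) (k l : nat -> int).

(** The letter [i] witnesses [0 < m], which keeps the residue below [m]. *)
Lemma ltz_digit (z : int) i : (`|(z %% m)%Z| < m)%N.
Proof. by have := ltn_ord i; lia. Qed.

Definition rot_digit (z : int) i : 'I_m := Ordinal (ltz_digit (i%:Z + z) i).

Lemma rot_digitE z i : (rot_digit z i)%:Z%R = ((i%:Z + z)%R %% m)%Z.
Proof. by rewrite /=; have := ltn_ord i; lia. Qed.

Lemma rot_digitD z t i : rot_digit (z + t)%R i = rot_digit t (rot_digit z i).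
Proof.
apply: val_inj; apply: (can_inj absz_nat).
by rewrite !rot_digitE modzDml addrA.
Qed.

Lemma rot_digit0 i : rot_digit 0%R i = i.
Proof.
apply: val_inj; apply: (can_inj absz_nat).
by rewrite rot_digitE addr0 modz_small // ltz_nat ltn_ord.
Qed.

Lemma rot_digit_inj z : injective (rot_digit z).
Proof.
by apply: (can_inj (g := rot_digit (- z)%R)) => i; rewrite -rot_digitD subrr rot_digit0.
Qed.

(* The vector k = (k_0, k_1, ...) acts on the first m letters as the k_0-th power
   of an odometer; k_{2j} for j > 0 moves to position j below these letters, and
   k_{2j+1} moves to position j below the last letter.  Doubling indices makes
   the subgroup { m | k_0 } isomorphic to two copies of the whole group. *)
Definition odo_next k y : nat -> int :=
  if unlift ord_max y is Some i then
    fun j => if j == 0 then ((i%:Z + k 0)%R %/ m)%Z else k j.*2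
  else fun j => k j.*2.+1.

Definition odometer : (nat -> int) -> tree_aut m.+1 :=
  automaton_aut (fun k => lift_perm ord_max ord_max (perm (@rot_digit_inj (k 0)))) odo_next.

Lemma sigma_odometer_last k : sigma (odometer k) ord_max = ord_max.
Proof. by rewrite sigma_automaton lift_perm_id. Qed.

Lemma sigma_odometer_lift k i :
  sigma (odometer k) (lift ord_max i) = lift ord_max (rot_digit (k 0) i).
Proof. by rewrite sigma_automaton lift_perm_lift permE. Qed.

Lemma section_odometer k y : section (odometer k) y = odometer (odo_next k y).
Proof. exact: section_automaton. Qed.

Lemma odometerD : {morph odometer : k l / (fun j => k j + l j)%R >-> k * l}.
Proof.
apply: automaton_autM => k l y.
  case: (unliftP ord_max y) => [i ->|->]; last by rewrite !lift_perm_id.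
  by rewrite !lift_perm_lift !permE rot_digitD.
apply/funext => j; rewrite /odo_next; case: (unliftP ord_max y) => [i ->|->].
  rewrite lift_perm_lift permE liftK; case: eqP => // _.
  (* The carry is a cocycle: adding [k 0] and then [l 0] to the digit [i] carries in total as much
     as adding [k 0 + l 0] at once. *)
  rewrite rot_digitE addrA [in LHS](divz_eq (i%:Z + k 0)%R m) -addrA divzMDl //.
  by have := ltn_ord i; lia.
by rewrite lift_perm_id unlift_none.
Qed.

Lemma odometer0 : odometer (fun=> 0%R) = 1.
Proof.
apply: (mulgI (odometer (fun=> 0%R))); rewrite -odometerD mulg1.
by congr odometer; apply/funext => j; rewrite addr0.
Qed.

Lemma odometerN k : odometer (fun j => - k j)%R = (odometer k)^-1.
Proof.
apply: (mulgI (odometer k)); rewrite -odometerD mulgV -odometer0.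
by congr odometer; apply/funext => j; rewrite subrr.
Qed.

Hypothesis m_gt1 : (1 < m)%N.
Let m_gt0 := ltnW m_gt1.
Let i0 := Ordinal m_gt0.

Lemma odometer_eq1_next k y : odometer k = 1 -> odometer (odo_next k y) = 1.
Proof. by move=> k1; rewrite -section_odometer k1 section1. Qed.

Lemma odometer_eq1_dvd k : odometer k = 1 -> (k 0 = (k 0%N %/ m)%Z * m%:Z)%R.
Proof.
move=> k1; have := sigma_odometer_lift k i0; rewrite k1 sigma1 => /lift_inj.
move/(congr1 (fun i : 'I_m => i%:Z%R)); rewrite rot_digitE /= add0r => k0.
by rewrite {1}(divz_eq (k 0) m) -k0 addr0.
Qed.

(** Descent on the absolute value of [k 0]: the section at digit 0 is again trivial with head
    [k 0 / m], which is smaller unless [k 0 = 0], as [m > 1]. *)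
Lemma odometer_eq1_head k : odometer k = 1 -> k 0 = 0%R.
Proof.
have [N] := ubnP `|k 0|%N; elim: N k => // N IHN k ltkN k1.
have k0 := odometer_eq1_dvd k1.
have := IHN _ _ (odometer_eq1_next (lift ord_max i0) k1).
rewrite /odo_next liftK /= add0r => q0.
have [->|k_neq0] := eqVneq (k 0) 0%R; first by [].
rewrite k0 q0 ?mul0r //; move: k0 k_neq0 ltkN.
by move: (k 0) (_ %/ _)%Z => z q; nia.
Qed.

(** A section moves entry [j > 0] to position [j./2]: at the last letter for odd [j], at digit 0 for
    even [j]. Entry 0 is the previous lemma. *)
Lemma odometer_eq1 k : odometer k = 1 -> forall j, k j = 0%R.
Proof.
move=> + j; have [N] := ubnP j; elim: N j k => // N IHN j k ltjN k1.
have [->|j_gt0] := posnP j; first exact: odometer_eq1_head.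
have [j_odd|j_even] := boolP (odd j).
  have := IHN j./2 _ _ (odometer_eq1_next ord_max k1).
  rewrite /odo_next unlift_none (_ : j./2.*2.+1 = j); last by lia.
  by apply; lia.
have := IHN j./2 _ _ (odometer_eq1_next (lift ord_max i0) k1).
rewrite /odo_next liftK (_ : (j./2 == 0) = false); last by lia.
rewrite (_ : j./2.*2 = j); last by lia.
by apply; lia.
Qed.

Lemma odometer_inj : injective odometer.
Proof.
move=> k l kl; apply/funext => j; apply/eqP; rewrite -subr_eq0; apply/eqP.
apply: (odometer_eq1 (k := fun j => k j - l j)%R).
by rewrite (odometerD k (fun j => - l j)%R) odometerN kl mulgV.
Qed.

(** The state with section [k] at the first [m] letters and the zero vector at the last. The factor
    [m] makes the first-level rotation trivial and the carry equal to [k 0]. *)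
Definition double_first k : nat -> int :=
  fun j => if j == 0 then (k 0 * m%:Z)%R else if odd j then 0%R else k j./2.

Definition double_last k : nat -> int := fun j => if odd j then k j./2 else 0%R.

Lemma xmap_first_odometer k :
  xmap [set~ ord_max] (odometer k) = odometer (double_first k).
Proof.
apply: tree_aut_eq => y; rewrite ?sigma_xmap ?section_odometer;
    case: (unliftP ord_max y) => [i ->|->].
- rewrite sigma_odometer_lift; congr lift; apply: val_inj; apply: (can_inj absz_nat).
  by rewrite rot_digitE addrC modzMDl modz_small // ltz_nat ltn_ord.
- by rewrite sigma_odometer_last.
- rewrite section_xmap_in; last by move/eqP; rewrite eq_sym (negbTE (neq_lift _ _)).
  congr odometer; apply/funext => j; rewrite /odo_next liftK /double_first /=.
  case: eqP => [->|/eqP j0].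
    by rewrite addrC divzMDl ?divz_small ?addr0 ?ltz_nat ?ltn_ord //; lia.
  by rewrite double_eq0 (negbTE j0) odd_double doubleK.
- rewrite section_xmap_out; last by case.
  rewrite -odometer0; congr odometer; apply/funext => j.
  by rewrite /odo_next unlift_none /double_first /= odd_double.
Qed.

Lemma xmap_last_odometer k :
  xmap [set ord_max] (odometer k) = odometer (double_last k).
Proof.
apply: tree_aut_eq => y; rewrite ?sigma_xmap ?section_odometer;
    case: (unliftP ord_max y) => [i ->|->].
- by rewrite sigma_odometer_lift rot_digit0.
- by rewrite sigma_odometer_last.
- rewrite section_xmap_out; last by move/eqP; rewrite eq_sym (negbTE (neq_lift _ _)).
  rewrite -odometer0; congr odometer; apply/funext => j; rewrite /odo_next liftK.
  rewrite /double_last /= odd_double addr0 divz_small ?ltz_nat ?ltn_ord //.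
  by case: eqP.
- rewrite section_xmap_in //; congr odometer; apply/funext => j.
  by rewrite /odo_next unlift_none /double_last /= odd_double uphalf_double.
Qed.

(** Among all integer sequences, those of finite support form the free abelian group of countable
    rank. *)
Definition fin_supp k := exists N, forall j, N <= j -> k j = 0%R.

Lemma fin_supp_odo_next k y : fin_supp k -> fin_supp (odo_next k y).
Proof.
(* With [N.+1] the index [j] is positive, so entry 0, a quotient by [m], is avoided. *)
move=> [N kN]; exists N.+1 => j ltNj; rewrite /odo_next.
case: unlift => [i|]; last by apply: kN; lia.
by rewrite gtn_eqF ?kN //; lia.
Qed.

Lemma fin_supp_double_first k : fin_supp k -> fin_supp (double_first k).
Proof.
move=> [N kN]; exists N.*2.+1 => j ltNj; rewrite /double_first gtn_eqF; last by lia.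
by case: ifP => // _; apply: kN; lia.
Qed.

Lemma fin_supp_double_last k : fin_supp k -> fin_supp (double_last k).
Proof.
move=> [N kN]; exists N.*2 => j ltNj; rewrite /double_last.
by case: ifP => // _; apply: kN; lia.
Qed.

Definition odometer_group := odometer @` fin_supp.

Lemma odometer_subgroup : subgroup odometer_group.
Proof.
split.
- by exists (fun=> 0%R); [exists 0 | apply: odometer0].
- move=> _ _ [k [N kN] <-] [l [M lM] <-]; rewrite -odometerD.
  eexists; last by []; exists (maxn N M) => j.
  by rewrite geq_max => /andP[leNj leMj]; rewrite kN ?lM.
- move=> _ [k [N kN] <-]; rewrite -odometerN; eexists; last by [].
  by exists N => j leNj; rewrite kN ?oppr0.
Qed.

Lemma odometer_self_similar : self_similar odometer_group.
Proof.
apply: self_similar_closed => [|_ y [k k_fin <-]]; first exact: odometer_subgroup.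
by rewrite section_odometer; eexists; last by []; apply: fin_supp_odo_next.
Qed.

Lemma odometer_fix a : odometer_group a -> sigma a ord_max = ord_max.
Proof. by case=> k _ <-; apply: sigma_odometer_last. Qed.

Lemma odometer_transitive i j :
  exists2 a, odometer_group a & sigma a (lift ord_max i) = lift ord_max j.
Proof.
pose k n : int := if n == 0 then (j%:Z - i%:Z)%R else 0%R.
exists (odometer k); first by exists k => //; exists 1%N => -[].
rewrite sigma_odometer_lift; congr lift; apply: val_inj; apply: (can_inj absz_nat).
by rewrite rot_digitE /k /= addrC subrK modz_small // ltz_nat ltn_ord.
Qed.

Lemma odometer_orbit_type : orbit_type odometer_group [:: m; 1%N].
Proof.
exact: (orbit_type_last odometer_subgroup odometer_fix odometer_transitive).
Qed.

(** Both orbit maps send the group into itself, through [double_first] and [double_last]; the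
    identity of the monoid gives the converse inclusion. *)
Lemma Delta_odometer : Delta odometer_group = odometer_group.
Proof.
apply/seteqP; split=> a.
  apply: gen_subgroup_min; first exact: odometer_subgroup.
  move=> _ [f Df [c Gc <-]]; elim: Df => // {}f y _ [k k_fin fc] /=; rewrite -fc.
  case: (unliftP ord_max y) => [i ->|->].
    rewrite (orbit1_lift odometer_fix odometer_transitive).
    by rewrite xmap_first_odometer; eexists; last by []; apply: fin_supp_double_first.
  rewrite (orbit1_last odometer_subgroup odometer_fix) xmap_last_odometer.
  by eexists; last by []; apply: fin_supp_double_last.
by move=> Ga; apply: (Delta_mem (Delta_id _) Ga).
Qed.

End FreeOdometer.

(** * Coordinates in a free abelian group of countable rank *)

Section Coordinates.
Variables (T : groupType) (b : nat -> T).
Hypotheses (bC : forall i j, commute (b i) (b j)) (bT : [set: T] = gen_subgroup (range b))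
  (b_free : forall (s : seq nat) (k : nat -> int), uniq s ->
      \prod_(i <- s) zexpg (b i) (k i) = 1 -> {in s, forall i, k i = 0%R}).

(** Existence of coordinates rests on generation, uniqueness on freeness. As [k] vanishes from [N]
    on, larger bounds give the same combination, so two bounds can be merged. *)
Definition has_coords (x : T) (k : nat -> int) :=
  exists2 N, (forall j, N <= j -> k j = 0%R) & lincomb b N k = x.

Lemma has_coordsD x y k l : has_coords x k -> has_coords y l ->
  has_coords (x * y) (fun j => k j + l j)%R.
Proof.
move=> [N kN <-] [M lM <-]; exists (maxn N M) => [j|].
  by rewrite geq_max => /andP[leNj leMj]; rewrite kN ?lM.
rewrite lincombD //; congr (_ * _); apply: lincomb_widen => //.
  exact: leq_maxl.
exact: leq_maxr.
Qed.

Lemma has_coordsN x k : has_coords x k -> has_coords x^-1 (fun j => - k j)%R.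
Proof.
by move=> [N kN <-]; exists N => [j leNj|]; rewrite ?kN ?oppr0 ?lincombN.
Qed.

Lemma has_coords_exists x : exists k, has_coords x k.
Proof.
have : [set: T] x by []; rewrite bT.
apply: (@gen_subgroup_min _ _ [set x | exists k, has_coords x k]).
  split=> [|y z [k yk] [l zl]|y [k yk]].
  - by exists (fun=> 0%R), 0 => //; apply: lincomb0.
  - by eexists; apply: has_coordsD yk zl.
  - by eexists; apply: has_coordsN yk.
move=> _ [i _ <-]; exists (fun j => (j == i)%:R%R), i.+1; last exact: lincomb_delta.
by move=> j ltij; rewrite gtn_eqF.
Qed.

Lemma has_coords1 k : has_coords 1 k -> forall j, k j = 0%R.
Proof.
move=> [N kN k1] j; have [leNj|ltjN] := leqP N j; first exact: kN.
by apply: (b_free (iota_uniq 0 (N - 0)) k1); rewrite mem_index_iota.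
Qed.

Lemma has_coords_inj x k l : has_coords x k -> has_coords x l -> k = l.
Proof.
move=> xk xl; apply/funext => j; apply/eqP; rewrite -subr_eq0; apply/eqP.
have := has_coordsD xk (has_coordsN xl); rewrite mulgV => /has_coords1.
exact.
Qed.

Definition coords x := projT1 (cid (has_coords_exists x)).

Lemma coordsP x : has_coords x (coords x).
Proof. by rewrite /coords; case: (cid _). Qed.

Lemma coordsM : {morph coords : x y / x * y >-> (fun j => x j + y j)%R}.
Proof.
by move=> x y; apply: (has_coords_inj (coordsP _)); apply: has_coordsD; apply: coordsP.
Qed.

Lemma coords_inj : injective coords.
Proof.
move=> x y xy; have [N kN <-] := coordsP x; have := coordsP y; rewrite -xy => -[M lM <-].
by rewrite -(lincomb_widen b kN (leq_maxl N M)) (lincomb_widen b lM (leq_maxr N M)).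
Qed.

Lemma range_coords : range coords = fin_supp.
Proof.
apply/seteqP; split=> [_ [x _ <-]|k [N kN]].
  by have [N kN _] := coordsP x; exists N.
exists (lincomb b N k) => //.
by apply: (has_coords_inj (coordsP _)); exists N.
Qed.

End Coordinates.

(** Coordinates identify [A] with the sequences of finite support, on which the odometer
    representation is faithful. *)
Lemma free_abelian_Delta_invariant (A : groupType) m : (1 < m)%N ->
  free_abelian nat [set: A] ->
  exists f : A -> tree_aut m.+1,
    [/\ {morph f : a b / a * b}, injective f,
        self_similar (range f), orbit_type (range f) [:: m; 1%N] &
        Delta (range f) = range f].
Proof.
move=> m_gt1 [cA [b bT b_free]].
have bC i j : commute (b i) (b j) by apply: cA.
pose c := coords bC bT; pose f x := @odometer m (c x).
have fE : range f = @odometer_group m.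
  rewrite /odometer_group -(range_coords bC bT b_free).
  by apply/seteqP; split=> [_ [x _ <-]|_ [_ [x _ <-] <-]]; [exists (c x) => //|]; exists x.
exists f; rewrite fE; split.
- by move=> x y; rewrite /f /c coordsM // odometerD.
- by move=> x y /(odometer_inj m_gt1) /coords_inj.
- exact: odometer_self_similar.
- exact: odometer_orbit_type.
- exact: Delta_odometer.
Qed.

Theorem theoremC :
  (* (i) finite rank r *)
  (forall r : nat,
    (* (a) *)
    (forall (n : nat) (A : set (tree_aut n)),
      (2 <= n)%N -> (1 <= r)%N ->
      free_abelian 'I_r A -> self_similar A -> ~ transitive1 A ->
      ~ finitely_generated (Delta A)) /\
    (* (b) *)
    (forall (m : nat) (A : set (tree_aut m)),
      (2 <= m)%N ->
      free_abelian 'I_r A -> self_similar A -> transitive1 A ->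
      exists f : tree_aut m -> tree_aut m.+1,
        [/\ {in A &, {morph f : a b / a * b}},
            extends_action A f,
            self_similar (f @` A) /\ ~ transitive1 (f @` A),
            orbit_type (f @` A) [:: m; 1%N] &
            exists B : set (tree_aut m.+1),
              [/\ B `<=` Delta (f @` A), self_similar B &
                  free_abelian nat B]])) /\
  (* (ii) countably infinite rank *)
  (forall (A : groupType), free_abelian nat [set: A] ->
    forall m : nat, (2 <= m)%N ->
    exists f : A -> tree_aut m.+1,
      [/\ {morph f : a b / a * b}, injective f,
          self_similar (range f), orbit_type (range f) [:: m; 1%N] &
          Delta (range f) = range f]).
Proof.
split=> [r|A freeA m m_gt1]; last exact: free_abelian_Delta_invariant.
split=> [n A _|m A]; [exact: Delta_not_fg | exact: transitive_extension].
Qed.
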